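(* Let $K_1, K_2$ be compact (Hausdorff) spaces such that both admit continuous surjections onto the cube $[0,1]^\kappa$ for some cardinal number $\kappa\ge 1$. Then $\mathcal C(K_1\times K_2)$ contains a complemented subspace isomorphic to $\mathcal C([0,1]^\kappa)$.
   Context: For a compact space $K$, $\mathcal C(K)$ denotes the Banach space of continuous real-valued functions on $K$ with the supremum norm. *)

(* Defs.v *)
From HB Require Import structures.
From mathcomp Require Import all_boot all_order all_algebra.
From mathcomp Require Import all_classical all_reals all_analysis.
Set Implicit Arguments. Unset Strict Implicit. Unset Printing Implicit Defensive.
Import Order.TTheory GRing.Theory Num.Theory.
Import numFieldNormedType.Exports.
Local Open Scope classical_set_scope.
Local Open Scope ring_scope.

Section CK.
Variable R : realType.

(* The Tychonoff cube [0,1]^I : the subset of the product space {ptws I -> R}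
   (product topology) of functions with values in [0,1], with the subspace
   topology (sigma type `set_type` with the initial topology). *)
Definition cube_set (I : Type) : set {ptws I -> R} :=
  [set g | forall i, 0 <= g i <= 1].
Definition cube (I : Type) : topologicalType := set_type (@cube_set I).

Definition Cfun (K : topologicalType) : set (K -> R) :=
  [set f | continuous f].

Definition supnorm (K : topologicalType) (f : K -> R) : R :=
  sup (range (fun x => `|f x|)).

Definition bounded_linear_op (K L : topologicalType)
    (T : (K -> R) -> (L -> R)) : Prop :=
  [/\ forall f, Cfun f -> Cfun (T f),
      forall (a : R) f g, Cfun f -> Cfun g ->
        T (fun x => a * f x + g x) = (fun y => a * T f y + T g y)
    & exists M : R, forall f, Cfun f -> supnorm (T f) <= M * supnorm f].

Definition has_complemented_copy (K L : topologicalType) : Prop :=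
  exists (P : (K -> R) -> (K -> R)) (J : (L -> R) -> (K -> R)),
    [/\ bounded_linear_op P,
        forall f, Cfun f -> P (P f) = P f,
        bounded_linear_op J,
        J @` (@Cfun L) = P @` (@Cfun K)
      & exists m : R, 0 < m /\
          forall f, Cfun f -> m * supnorm f <= supnorm (J f)].

End CK.

(* Main.v *)
Require Import Defs.
From HB Require Import structures.
From mathcomp Require Import all_boot all_order all_algebra.
From mathcomp Require Import finmap ring lra.
From mathcomp Require Import all_classical all_reals all_analysis.
Import Order.TTheory GRing.Theory Num.Theory.
Import numFieldNormedType.Exports.
Set Implicit Arguments. Unset Strict Implicit. Unset Printing Implicit Defensive.
Local Open Scope classical_set_scope.
Local Open Scope ring_scope.

(* Let [C] be the Cantor group {0,1}^(I * nat). Continuous extensions of the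
   ternary digits of the Cantor set, composed with the given surjections, provide
   points of [K1] and [K2] with any prescribed digits; averaging over such points
   along an ultrafilter yields functionals on bounded functions which behave like
   Haar measure on [C]. Adding digits modulo 2 and evaluating the expansion
   sum_k (1/3) (2/3)^k c_k gives a continuous map from [K1 * K2] to [0,1]^I, and
   composition with it embeds C([0,1]^I).

   A norm-one left inverse is the composite of two averaging operators. The first
   averages f : K1 * K2 -> R over the pairs whose digits sum to c; the result is
   continuous in c because convolution smooths: the conditional expectations of a
   bounded function given finitely many digits form an L^2-bounded martingale,
   hence are Cauchy in mean, and the rows f(x, _) form a totally bounded family.
   The second is a Milutin operator from C(C) to C([0,1]^I), given by probability
   measures on the fibres of the expansion that depend continuously on the point. *)

(** * Means and limits along finite sets *)

Section Means.
Context {R : realType}.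

Definition bnd (T : Type) (f : T -> R) : Prop := exists M, forall a, `|f a| <= M.

Section BoundedFunctions.
Context {T : Type}.
Implicit Types f g : T -> R.

Lemma bnd_cst c : bnd (fun _ : T => c).
Proof. by exists `|c|. Qed.

Lemma bndD f g : bnd f -> bnd g -> bnd (fun a => f a + g a).
Proof.
move=> [M hM] [N hN]; exists (M + N) => a.
by rewrite (le_trans (ler_normD _ _))// lerD.
Qed.

Lemma bndM f g : bnd f -> bnd g -> bnd (fun a => f a * g a).
Proof.
move=> [M hM] [N hN]; exists (M * N) => a.
by rewrite normrM ler_pM.
Qed.

Lemma bndN f : bnd f -> bnd (fun a => - f a).
Proof. by move=> [M hM]; exists M => a; rewrite normrN. Qed.

Lemma bndB f g : bnd f -> bnd g -> bnd (fun a => f a - g a).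
Proof. by move=> bf bg; apply: bndD => //; apply: bndN. Qed.

Lemma bnd_norm f : bnd f -> bnd (fun a => `|f a|).
Proof. by move=> [M hM]; exists M => a; rewrite normr_id. Qed.

Lemma bnd_comp (U : Type) (h : U -> T) f : bnd f -> bnd (fun u => f (h u)).
Proof. by move=> [M hM]; exists M. Qed.

Lemma bnd_sum (K : eqType) (s : seq K) (F : K -> T -> R) :
  {in s, forall k, bnd (F k)} -> bnd (fun a => \sum_(k <- s) F k a).
Proof.
elim: s => [|k s ih] h.
  by exists 0 => a; rewrite big_nil normr0.
have [M hM] : bnd (fun a => F k a + \sum_(k <- s) F k a).
  apply: bndD; first by apply: h; rewrite inE eqxx.
  by apply: ih => j js; apply: h; rewrite inE js orbT.
by exists M => a; rewrite big_cons.
Qed.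

Lemma bnd_prod (K : Type) (s : seq K) (F : K -> T -> R) :
  (forall k, bnd (F k)) -> bnd (fun a => \prod_(k <- s) F k a).
Proof.
move=> h; elim: s => [|k s [M hM]].
  by exists 1 => a; rewrite big_nil normr1.
have [N hN] := h k; exists (N * M) => a.
by rewrite big_cons normrM ler_pM.
Qed.

End BoundedFunctions.

(** A finitely additive probability, given as an expectation; its laws are required on bounded
    functions only. *)
Record is_mean (T : Type) (L : (T -> R) -> R) : Prop := IsMean {
  mean_lin : forall a f g, bnd f -> bnd g ->
    L (fun x => a * f x + g x) = a * L f + L g;
  mean_le : forall f g, bnd f -> bnd g -> (forall x, f x <= g x) -> L f <= L g;
  mean_cst : forall c, L (fun _ => c) = c }.

Section MeanTheory.
Context {T : Type} {L : (T -> R) -> R} (Lm : is_mean L).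
Implicit Types f g : T -> R.

Lemma meanD f g : bnd f -> bnd g -> L (fun x => f x + g x) = L f + L g.
Proof.
move=> bf bg; rewrite -[L f]mul1r -mean_lin//.
by congr L; apply/funext => x; rewrite mul1r.
Qed.

Lemma meanZ a f : bnd f -> L (fun x => a * f x) = a * L f.
Proof.
move=> bf; have := mean_lin Lm a bf (bnd_cst 0).
rewrite (mean_cst Lm) addr0 => <-.
by congr L; apply/funext => x; rewrite addr0.
Qed.

Lemma meanB f g : bnd f -> bnd g -> L (fun x => f x - g x) = L f - L g.
Proof.
move=> bf bg; rewrite -[- L g]mulN1r addrC -mean_lin//.
by congr L; apply/funext => x; rewrite mulN1r addrC.
Qed.

Lemma mean_sum (K : eqType) (s : seq K) (F : K -> T -> R) :
  {in s, forall k, bnd (F k)} ->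
  L (fun x => \sum_(k <- s) F k x) = \sum_(k <- s) L (F k).
Proof.
elim: s => [|k s ih] h.
  rewrite big_nil -[RHS](mean_cst Lm); congr L.
  by apply/funext => x; rewrite big_nil.
have hs : {in s, forall k, bnd (F k)}.
  by move=> j js; apply: h; rewrite inE js orbT.
rewrite big_cons -ih// -meanD//.
- by congr L; apply/funext => x; rewrite big_cons.
- by apply: h; rewrite inE eqxx.
- exact: bnd_sum.
Qed.

Lemma mean_norm_le f g :
  bnd g -> (forall x, `|f x| <= g x) -> `|L f| <= L g.
Proof.
move=> bg fg; have bf : bnd f.
  by have [M hM] := bg; exists M => x; rewrite (le_trans (fg x))// (le_trans _ (hM x))// ler_norm.
rewrite ler_norml -mulN1r -meanZ//; apply/andP; split; apply: mean_le => //.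
- by apply: bndM => //; exact: bnd_cst.
- by move=> x; rewrite mulN1r; have := fg x; rewrite ler_norml => /andP[].
- by move=> x; exact: le_trans (ler_norm _) (fg x).
Qed.

Lemma mean_norm_cst f c : (forall x, `|f x| <= c) -> `|L f| <= c.
Proof.
by move=> h; rewrite -(mean_cst Lm c); apply: mean_norm_le => //; exact: bnd_cst.
Qed.

Lemma mean_sub_cst f c e : bnd f -> (forall x, `|f x - c| <= e) -> `|L f - c| <= e.
Proof.
move=> bf h; rewrite -{1}(mean_cst Lm c) -meanB//; last exact: bnd_cst.
exact: mean_norm_cst.
Qed.

End MeanTheory.

Section UltrafilterLimit.
Variables (T : Type) (U : set_system T).
Hypothesis UU : UltraFilter U.

Let ulimit (f : T -> R) : R := lim (f @ U).

(** The image of an ultrafilter is an ultrafilter, and in the compact interval [[-M, M]] every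
    ultrafilter converges. *)
Let ulimit_cvg f : bnd f -> f @ U --> ulimit f.
Proof.
move=> [M hM]; have := @segment_compact R (- M) M.
rewrite compact_ultra => /(_ (f @ U)) [].
- apply: Build_UltraFilter => G PG sG; apply/seteqP; split; last exact: sG.
  move=> A GA; have [//|UnA] := in_ultra_setVsetC (f @^-1` A) UU.
  have : G (~` A) by apply: sG.
  by move/(filterI GA); rewrite setICr => /filter_not_empty.
- apply: (@filterE _ U) => x; rewrite /= in_itv/=; have := hM x.
  by rewrite ler_norml.
- by move=> p [_ fp]; apply/cvg_ex; exists p.
Qed.

Lemma ultrafilter_mean : is_mean ulimit.
Proof.
split.
- move=> a f g bf bg; apply/cvg_lim => //.
  exact: (cvgD (cvgMl_tmp (ulimit_cvg bf)) (ulimit_cvg bg)).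
- move=> f g bf bg fg; rewrite -subr_ge0.
  have gf : (g - f) @ U --> ulimit g - ulimit f by apply: cvgB; exact: ulimit_cvg.
  rewrite -(cvg_lim (@Rhausdorff R) gf); apply: limr_ge; first exact: cvgP gf.
  by apply: filterE => x /=; rewrite subr_ge0; exact: fg.
- by move=> c; apply/cvg_lim => //; exact: cvg_cst.
Qed.

Lemma ultrafilter_mean_eq0 f : U [set x | f x = 0] -> ulimit f = 0.
Proof.
move=> Uf; apply/cvg_lim => //; apply: (@cvg_trans _ ((fun _ => 0 : R) @ U)).
  apply: near_eq_cvg; near=> x; apply/esym; near: x; exact: Uf.
exact: cvg_cst.
Unshelve. all: by end_near. Qed.

End UltrafilterLimit.

Section DirectedLimit.
Context {J : choiceType}.

(** The cones of finite sets above a given one form a filter base; the limit is taken along an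
    ultrafilter refining it. The second clause records that only large [S] matter. *)
Lemma exists_ulim : exists L : ({fset J} -> R) -> R, is_mean L /\
  forall S0 f, (forall S, (S0 `<=` S)%fset -> f S = 0) -> L f = 0.
Proof.
pose F := filter_from [set: {fset J}] (fun S0 => [set S | (S0 `<=` S)%fset]).
have PF : ProperFilter F.
  apply: filter_from_proper; last by move=> S _; exists S => /=; exact: fsubset_refl.
  apply: filter_from_filter; first by exists fset0.
  move=> A B _ _; exists (A `|` B)%fset => // S /=.
  by rewrite fsubUset => /andP[].
have [G [UG sG]] := ultraFilterLemma PF.
exists (fun f => lim (f @ G)); split; first exact: ultrafilter_mean.
move=> S0 f h; apply: ultrafilter_mean_eq0; apply: sG; exists S0 => // S /=; exact: h.
Qed.

Definition ulim := sval (cid exists_ulim).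

Lemma ulim_mean : is_mean ulim.
Proof. exact: (svalP (cid exists_ulim)).1. Qed.

Lemma ulim_eq S0 f g : bnd f -> bnd g ->
  (forall S, (S0 `<=` S)%fset -> f S = g S) -> ulim f = ulim g.
Proof.
move=> bf bg h; apply/eqP; rewrite -subr_eq0 -(meanB ulim_mean)//; apply/eqP.
by apply: (svalP (cid exists_ulim)).2 => S /h ->; rewrite subrr.
Qed.

Lemma ulim_near S0 f c e : bnd f -> 0 <= e ->
  (forall S, (S0 `<=` S)%fset -> `|f S - c| <= e) -> `|ulim f - c| <= e.
Proof.
(* Outside the cone above [S0], which the limit ignores, [f] is replaced by [c]; the bound then
   holds everywhere. *)
move=> bf e0 h; pose g S := if (S0 `<=` S)%fset then f S else c.
have hg S : `|g S - c| <= e.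
  by rewrite /g; case: ifP => [/h//|]; rewrite subrr normr0.
have bg : bnd g.
  exists (e + `|c|) => S; rewrite -[g S](subrK c).
  by rewrite (le_trans (ler_normD _ _))// lerD2r.
rewrite (@ulim_eq S0 f g)//; first exact: (mean_sub_cst ulim_mean).
by move=> S; rewrite /g => ->.
Qed.

Lemma ulim_of_means (T : Type) (L : {fset J} -> (T -> R) -> R) :
  (forall S, is_mean (L S)) -> is_mean (fun f => ulim (fun S => L S f)).
Proof.
move=> Lm.
have bL f : bnd f -> bnd (fun S => L S f).
  by move=> [M hM]; exists M => S; exact: (mean_norm_cst (Lm S)).
split=> [a f g bf bg|f g bf bg fg|c].
- rewrite -(mean_lin ulim_mean); [|exact: bL..].
  by congr ulim; apply/funext => S; rewrite (mean_lin (Lm S)).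
- apply: (mean_le ulim_mean); [exact: bL..|].
  by move=> S; exact: (mean_le (Lm S)).
- rewrite -[RHS](mean_cst ulim_mean); congr ulim; apply/funext => S.
  by rewrite (mean_cst (Lm S)).
Qed.

End DirectedLimit.
End Means.

(** * An invariant mean on the finite subsets of a set *)

Section SymmetricDifference.
Context {J : choiceType}.
Implicit Types A B C S : {fset J}.

(** Addition modulo 2 in the Cantor group, on its finitely supported elements. *)
Definition symd A B := ((A `\` B) `|` (B `\` A))%fset.

Lemma in_symd A B j : (j \in symd A B) = (j \in A) (+) (j \in B).
Proof. by rewrite !inE; case: (j \in A); case: (j \in B). Qed.

Lemma symdC A B : symd A B = symd B A.
Proof. by apply/fsetP => j; rewrite !in_symd addbC. Qed.

Lemma symdK A B : symd (symd A B) B = A.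
Proof. by apply/fsetP => j; rewrite !in_symd addbK. Qed.

Lemma symd_sub A B S : (A `<=` S)%fset -> (B `<=` S)%fset -> (symd A B `<=` S)%fset.
Proof.
move=> /fsubsetP AS /fsubsetP BS; apply/fsubsetP => j; rewrite in_symd.
by have := AS j; have := BS j; case: (j \in A) (j \in B) => -[] //= h1 h2 _; auto.
Qed.

End SymmetricDifference.

Section InvariantMean.
Context {R : realType} {J : choiceType}.
Implicit Types A B C D S : {fset J}.
Implicit Types f g h : {fset J} -> R.

(** Integration against Haar measure on [{0,1}^S], whose points are the subsets of [S]. *)
Definition avg S f : R := (\sum_(D <- fpowerset S) f D) / (2 ^ #|` S|)%:R.

Lemma avg_mean S : is_mean (avg S).
Proof.
have N0 : (2 ^ #|` S|)%:R != 0 :> R by rewrite pnatr_eq0 expn_eq0.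
split=> [a f g _ _|f g _ _ fg|c]; rewrite /avg.
- by rewrite big_split/= -mulr_sumr mulrDl mulrA.
- rewrite ler_wpM2r// ?invr_ge0 ?ler0n//.
  by apply: ler_sum => D _; exact: fg.
- rewrite big_const_seq count_predT iter_addr addr0.
  by rewrite card_fpowerset -[c *+ _]mulr_natr mulfK.
Qed.

Lemma avg_shift S f C : (C `<=` S)%fset ->
  avg S (fun A => f (symd A C)) = avg S f.
Proof.
move=> CS; rewrite /avg; congr (_ / _).
rewrite -(big_map (fun D => symd D C) xpredT f); apply: perm_big.
apply: uniq_perm => [||D]; last 1 first.
- rewrite fpowersetE; apply/mapP/idP => [[E]|DS].
    by rewrite fpowersetE => ES ->; exact: symd_sub.
  by exists (symd D C); rewrite ?symdK// fpowersetE; exact: symd_sub.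
- by rewrite map_inj_uniq ?fset_uniq// => A B AB; rewrite -[A](symdK _ C) AB symdK.
- exact: fset_uniq.
Qed.

Lemma bnd_avg f : bnd f -> bnd (avg ^~ f).
Proof. by move=> [M hM]; exists M => S; exact: (mean_norm_cst (avg_mean S)). Qed.

Definition invm f : R := ulim (avg ^~ f).

Lemma invm_mean : is_mean invm.
Proof. exact: ulim_of_means avg_mean. Qed.

(** For every [S] above [C], translation by [C] permutes the subsets of [S], so the averages agree
    from [C] on. *)
Lemma invm_shift f C : bnd f -> invm (fun A => f (symd A C)) = invm f.
Proof.
move=> bf; apply: (@ulim_eq _ _ C); [|exact: bnd_avg|by move=> S; exact: avg_shift].
by apply: bnd_avg; exact: (bnd_comp (fun A => symd A C)).
Qed.

(** By translation invariance [u] and its flip at [j] contribute equally, and together they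
    contribute [2 * invm f]. *)
Lemma invm_factor j f u : bnd f -> bnd u ->
  (forall A, f (symd A [fset j]%fset) = f A) ->
  (forall A, u A + u (symd A [fset j]%fset) = 2) ->
  invm (fun A => f A * u A) = invm f.
Proof.
move=> bf bu fj uj; have b2 := bndM bf bu.
have bfl : bnd (fun A => f A * u (symd A [fset j]%fset)).
  by apply: bndM => //; exact: (bnd_comp (fun A => symd A _)).
have e1 : invm (fun A => f A * u (symd A [fset j]%fset)) = invm (fun A => f A * u A).
  rewrite -(invm_shift [fset j]%fset b2); congr invm; apply/funext => A /=.
  by rewrite fj.
suff : invm (fun A => f A * u A) + invm (fun A => f A * u (symd A [fset j]%fset)) = 2 * invm f.
  by rewrite e1; lra.
rewrite -(meanD invm_mean)// -(meanZ invm_mean)//.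
by congr invm; apply/funext => A; rewrite -mulrDr uj mulrC.
Qed.

(** Factors are integrated out one at a time, highest rank first: a flip at an index of maximal rank
    leaves all other factors unchanged, so [invm_factor] applies. *)
Lemma invm_prod (u : J -> {fset J} -> R) (rk : J -> nat) f (s : seq J) :
  bnd f -> (forall j, bnd (u j)) -> uniq s ->
  (forall j A, u j A + u j (symd A [fset j]%fset) = 2) ->
  (forall i j A, i != j -> (rk i <= rk j)%N -> u i (symd A [fset j]%fset) = u i A) ->
  {in s, forall j A, f (symd A [fset j]%fset) = f A} ->
  invm (fun A => f A * \prod_(j <- s) u j A) = invm f.
Proof.
move=> bf bu us u2 ur; have [n] := ubnP (size s); elim: n s us => // n ih s us.
case: s us => [_ _ _|j0 s0 us sn fs].
  by congr invm; apply/funext => A; rewrite big_nil mulr1.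
set s := j0 :: s0 in us sn fs *.
have [j js jmax] : exists2 j, j \in s & {in s, forall i, (rk i <= rk j)%N}.
  have : s != [::] by [].
  elim: (s) => // a [_|b r /(_ isT) [j js jm]] _.
    by exists a; rewrite ?mem_seq1// => i; rewrite mem_seq1 => /eqP ->.
  have [ja|aj] := leqP (rk j) (rk a).
    exists a; rewrite ?mem_head// => i; rewrite in_cons => /orP[/eqP ->//|/jm ij].
    exact: leq_trans ij ja.
  exists j; first by rewrite in_cons js orbT.
  by move=> i; rewrite in_cons => /orP[/eqP ->|/jm//]; exact: ltnW.
have rs i : i \in rem j s -> i \in s by exact: mem_rem.
transitivity (invm (fun A => (f A * \prod_(i <- rem j s) u i A) * u j A)).
  congr invm; apply/funext => A; rewrite (perm_big _ (perm_to_rem js))/= big_cons.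
  by rewrite -mulrA; congr (_ * _); rewrite mulrC.
rewrite (@invm_factor j)//.
- apply: ih; first exact: rem_uniq.
    by rewrite size_rem//; move: sn; rewrite /s/= ltnS.
  by move=> i /rs; exact: fs.
- by apply: bndM => //; exact: bnd_prod.
- move=> A; rewrite fs//; congr (_ * _); rewrite big_seq [RHS]big_seq.
  apply: eq_bigr => i irs; apply: ur; last exact/jmax/rs.
  by move: irs; rewrite mem_rem_uniq// inE => /andP[].
Qed.

(** * Conditional expectations given finitely many coordinates *)

Definition depends_on S f := forall A B,
  {in S, forall j, (j \in A) = (j \in B)} -> f A = f B.

Lemma depends_on_sub S S' f : (S `<=` S')%fset -> depends_on S f -> depends_on S' f.
Proof.
by move=> /fsubsetP SS' df A B AB; apply: df => j /SS'; exact: AB.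
Qed.

Lemma depends_onM S f g :
  depends_on S f -> depends_on S g -> depends_on S (fun A => f A * g A).
Proof. by move=> df dg A B AB; rewrite (df A B)// (dg A B). Qed.

Lemma depends_on_flip S f j : depends_on S f -> j \notin S ->
  forall A, f (symd A [fset j]%fset) = f A.
Proof.
move=> df jS A; apply: df => i iS; rewrite in_symd inE.
by case: eqP => [ij|]; rewrite ?addbF//; move: jS; rewrite -ij iS.
Qed.

(* For the mean [invm], [cyl S] is the density of the conditional probability
   given that the coordinates in [S] vanish. *)
Definition cyl S D : R := \prod_(j <- S) (if j \in D then 0 else 2).

Lemma cyl_ge0 S D : 0 <= cyl S D.
Proof. by apply: prodr_ge0 => j _; case: ifP. Qed.

Lemma cyl_eq0 S D j : j \in S -> j \in D -> cyl S D = 0.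
Proof.
move=> jS jD; rewrite /cyl (big_rem j)//= jD mul0r//.
Qed.

Lemma cyl_val S D : {in S, forall j, j \notin D} -> cyl S D = (2 ^ #|` S|)%:R.
Proof.
move=> h; rewrite /cyl big_seq (eq_bigr (fun=> 2)); last first.
  by move=> j /h /negbTE ->.
by rewrite -big_seq big_const_seq count_predT iter_mulr mulr1 natrX.
Qed.

Lemma bnd_cyl S : bnd (cyl S).
Proof. by apply: bnd_prod => j; exists 2 => D; case: ifP => _; rewrite ?normr0 ?ger0_norm. Qed.

Lemma depends_on_cyl S C : depends_on S (fun A => cyl S (symd A C)).
Proof.
move=> A B AB; rewrite /cyl big_seq [RHS]big_seq; apply: eq_bigr => j jS.
by rewrite !in_symd AB.
Qed.

Lemma bnd_cyl_shift S C : bnd (fun A => cyl S (symd A C)).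
Proof. by apply: (bnd_comp (fun A => symd A C)); exact: bnd_cyl. Qed.

Lemma invm_cyl S C : invm (fun A => cyl S (symd A C)) = 1.
Proof.
rewrite (invm_shift _ (bnd_cyl S)) -[RHS](mean_cst invm_mean).
transitivity (invm (fun A => 1 * cyl S A)).
  by congr invm; apply/funext => A; rewrite mul1r.
apply: (@invm_prod (fun j D => if j \in D then 0 else 2) (fun=> 0%N)).
- exact: bnd_cst.
- by move=> j; exists 2 => D; case: ifP => _; rewrite ?normr0 ?ger0_norm.
- exact: fset_uniq.
- by move=> j A; rewrite in_symd inE eqxx addbT; case: (j \in A) => /=; ring.
- by move=> i j A ij _; rewrite in_symd inE (negbTE ij) addbF.
- by [].
Qed.

(** Among the subsets [D] of [S] only the trace of [A] has nonzero weight, and that weight cancels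
    the normalisation of [avg]. *)
Lemma cyl_repr S f A : depends_on S f ->
  f A = avg S (fun D => f D * cyl S (symd A D)).
Proof.
move=> df; pose D0 := (A `&` S)%fset.
have D0S : D0 \in fpowerset S by rewrite fpowersetE fsubsetIr.
rewrite /avg (bigD1_seq D0 D0S (fset_uniq _))/= big1_seq ?addr0.
  rewrite cyl_val; last first.
    by move=> j jS; rewrite in_symd inE jS andbT addbb.
  rewrite mulfK ?pnatr_eq0 ?expn_eq0//.
  by apply: df => j jS; rewrite inE jS andbT.
move=> D /andP[DD0 ]; rewrite fpowersetE => DS.
have [j jS jAD] : exists2 j, j \in S & (j \in symd A D).
  apply: contrapT => h; move/eqP: DD0; apply; apply/fsetP => j.
  rewrite inE; have [jS|jS] := boolP (j \in S).
    rewrite andbT; apply/eqP/negPn/negP => jn; apply: h; exists j => //.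
    by rewrite in_symd; move: jn; case: (j \in A) (j \in D) => -[].
  by rewrite andbF; apply/negP => /(fsubsetP DS); exact/negP.
by rewrite (cyl_eq0 jS jAD) mulr0.
Qed.

(** Conditional expectation of [h] given that the coordinates in [S] agree with those of [C]. *)
Definition cexp S h C := invm (fun A => h A * cyl S (symd A C)).

Lemma cexp_norm S h M C : (forall A, `|h A| <= M) -> `|cexp S h C| <= M.
Proof.
move=> hM; rewrite -[M]mulr1 -(invm_cyl S C) -(meanZ invm_mean); last exact: bnd_cyl_shift.
apply: (mean_norm_le invm_mean) => [|A].
  by apply: bndM; [exact: bnd_cst|exact: bnd_cyl_shift].
by rewrite normrM (ger0_norm (cyl_ge0 _ _)) ler_wpM2r// cyl_ge0.
Qed.

Lemma bnd_cexp S h : bnd h -> bnd (cexp S h).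
Proof. by move=> [M hM]; exists M => A; exact: cexp_norm. Qed.

(** The density vanishes off the cylinder of [C], so only the values of [h] on that cylinder
    count. *)
Lemma cexp_near S h C (c e : R) : bnd h -> 0 <= e ->
  (forall B, {in S, forall j, (j \in B) = (j \in C)} -> `|h B - c| <= e) ->
  `|cexp S h C - c| <= e.
Proof.
move=> bh e0 hc; have bc := bnd_cyl_shift S C.
rewrite -[c]mulr1 -[e]mulr1 -(invm_cyl S C) -!(meanZ invm_mean)//.
rewrite /cexp -(meanB invm_mean); last 2 first.
- exact: bndM.
- by apply: bndM => //; exact: bnd_cst.
apply: (mean_norm_le invm_mean) => [|B]; first by apply: bndM => //; exact: bnd_cst.
rewrite -mulrBl normrM (ger0_norm (cyl_ge0 _ _)).
have [BC|/existsPNP [j jS /eqP jn]] := pselect {in S, forall j, (j \in B) = (j \in C)}.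
  by rewrite ler_wpM2r ?cyl_ge0// hc.
rewrite (@cyl_eq0 S _ j)// ?mulr0// in_symd.
by move: jn; case: (j \in B) (j \in C) => -[].
Qed.

Lemma cexp_lin S a h g C : bnd h -> bnd g ->
  cexp S (fun A => a * h A + g A) C = a * cexp S h C + cexp S g C.
Proof.
move=> bh bg; rewrite /cexp -(mean_lin invm_mean).
- by congr invm; apply/funext => A; rewrite mulrDl mulrA.
- by apply: bndM => //; exact: bnd_cyl_shift.
- by apply: bndM => //; exact: bnd_cyl_shift.
Qed.

Lemma cexpB S h g C : bnd h -> bnd g ->
  cexp S (fun A => h A - g A) C = cexp S h C - cexp S g C.
Proof.
move=> bh bg; rewrite /cexp -(meanB invm_mean).
- by congr invm; apply/funext => A; rewrite mulrBl.
- by apply: bndM => //; exact: bnd_cyl_shift.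
- by apply: bndM => //; exact: bnd_cyl_shift.
Qed.

Lemma depends_on_cexp S h : depends_on S (cexp S h).
Proof.
move=> C D CD; congr invm; apply/funext => A; congr (_ * _).
by rewrite ![symd A _]symdC; exact: depends_on_cyl.
Qed.

Lemma cexp_id S f C : bnd f -> depends_on S f -> cexp S f C = f C.
Proof.
move=> bf df; rewrite -[RHS]mulr1 -(invm_cyl S C) -(meanZ invm_mean); last exact: bnd_cyl_shift.
congr invm; apply/funext => A.
have [h|/existsPNP [j jS /negP]] := pselect {in S, forall j, j \notin symd A C}.
  congr (_ * _); apply: df => j /h; rewrite in_symd.
  by case: (j \in A) (j \in C) => -[].
by rewrite negbK => jn; rewrite (cyl_eq0 jS jn) !mulr0.
Qed.

(** [cyl_repr] writes [f] as a finite combination of cylinder densities, and the mean passes through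
    the finite sum. *)
Lemma invm_cylE S h f : bnd h -> depends_on S f ->
  invm (fun A => h A * f A) = avg S (fun D => f D * cexp S h D).
Proof.
move=> bh df; rewrite /avg.
have bt D : bnd (fun A => h A * (cyl S (symd A D))).
  by apply: bndM => //; exact: bnd_cyl_shift.
transitivity (invm (fun A => \sum_(D <- fpowerset S)
    (f D / (2 ^ #|` S|)%:R) * (h A * cyl S (symd A D)))).
  congr invm; apply/funext => A; rewrite (cyl_repr A df) /avg mulrA mulr_sumr mulr_suml.
  by apply: eq_bigr => D _; ring.
rewrite (mean_sum invm_mean); last first.
  by move=> D _; apply: bndM; [exact: bnd_cst|exact: bt].
rewrite mulr_suml; apply: eq_bigr => D _.
by rewrite (meanZ invm_mean)// mulrAC.
Qed.

(** By [invm_cylE] both sides depend on [h] only through its conditional expectation, which is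
    idempotent. *)
Lemma cexp_adj S h f : bnd h -> depends_on S f ->
  invm (fun A => cexp S h A * f A) = invm (fun A => h A * f A).
Proof.
move=> bh df; have bE := bnd_cexp S bh.
rewrite (invm_cylE bE df) (invm_cylE bh df); congr avg; apply/funext => D.
by rewrite (cexp_id _ bE (@depends_on_cexp S h)).
Qed.

(** Pythagoras: the martingale increment is orthogonal to the coarser expectation. *)
Lemma cexp_orth S S' h : bnd h -> (S `<=` S')%fset ->
  invm (fun A => (cexp S' h A - cexp S h A) ^+ 2) =
  invm (fun A => cexp S' h A ^+ 2) - invm (fun A => cexp S h A ^+ 2).
Proof.
move=> bh SS'; have b1 := bnd_cexp S bh; have b2 := bnd_cexp S' bh.
have dS := @depends_on_cexp S h.
have e : invm (fun A => cexp S' h A * cexp S h A) = invm (fun A => cexp S h A * cexp S h A).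
  rewrite (cexp_adj bh (depends_on_sub SS' dS)).
  by rewrite (cexp_adj bh dS).
have bq S1 : bnd (fun A => cexp S1 h A ^+ 2).
  by apply: bndM; exact: bnd_cexp.
rewrite (_ : (fun A => _) = fun A => (cexp S' h A ^+ 2 + cexp S h A ^+ 2)
    - 2 * (cexp S' h A * cexp S h A)); last by apply/funext => A; ring.
rewrite (meanB invm_mean); last 2 first.
- exact: bndD.
- by apply: bndM; [exact: bnd_cst|exact: bndM].
rewrite (meanD invm_mean)// (meanZ invm_mean); last exact: bndM.
rewrite e (_ : (fun A => cexp S h A * cexp S h A) = fun A => cexp S h A ^+ 2).
  by ring.
by apply/funext => A; rewrite expr2.
Qed.

(** The squared norms of the martingale increase and are bounded, so beyond some [S0] they vary by
    at most [e ^+ 2]; by orthogonality this bounds the squared increments. *)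
Lemma cexp_cauchy h e : bnd h -> 0 < e -> exists S0, forall S1 S,
  (S0 `<=` S1)%fset -> (S1 `<=` S)%fset ->
  invm (fun A => `|cexp S h A - cexp S1 h A|) <= e.
Proof.
move=> bh e0; have [M hM] := bh.
pose V S := invm (fun A => cexp S h A ^+ 2).
have Vmono S S' : (S `<=` S')%fset -> V S <= V S'.
  move=> SS'; rewrite -subr_ge0 -cexp_orth// -(mean_cst invm_mean 0).
  apply: (mean_le invm_mean) => [||A]; [exact: bnd_cst| |exact: sqr_ge0].
  by apply: bndM; apply: bndB; exact: bnd_cexp.
have hs : has_sup (range V).
  split; first by exists (V fset0), fset0.
  exists (M ^+ 2) => _ [S _ <-]; rewrite (le_trans (ler_norm _))//.
  apply: (mean_norm_cst invm_mean) => A; rewrite normrX.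
  by rewrite lerXn2r ?nnegrE//; [exact: le_trans (cexp_norm S A hM)|exact: cexp_norm].
have [_ [S0 _ <-] S0s] := sup_adherent (exprn_gt0 2 e0) hs.
exists S0 => S1 S S01 S1S.
have b1 := bnd_cexp S1 bh; have b2 := bnd_cexp S bh.
have bd : bnd (fun A => (cexp S h A - cexp S1 h A) ^+ 2).
  by apply: bndM; exact: bndB.
have q : invm (fun A => (cexp S h A - cexp S1 h A) ^+ 2) <= e ^+ 2.
  rewrite cexp_orth//; have := Vmono _ _ S01.
  have : V S <= sup (range V) by apply: ub_le_sup; [exact: hs.2|exists S].
  by rewrite -/(V S) -/(V S1); move: S0s; set s := sup _; lra.
(* AM-GM: [|x| <= (e + x ^ 2 / e) / 2]. *)
apply: (@le_trans _ _ (invm (fun A => e / 2 + (2 * e)^-1 * (cexp S h A - cexp S1 h A) ^+ 2))).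
  apply: (mean_le invm_mean) => [||A].
  - by apply: bnd_norm; exact: bndB.
  - by apply: bndD; [exact: bnd_cst|apply: bndM => //; exact: bnd_cst].
  - set x := _ - _; rewrite -[x ^+ 2]real_normK ?num_real//.
    have : 0 <= (`|x| - e) ^+ 2 / (2 * e).
      by rewrite divr_ge0 ?sqr_ge0// mulr_ge0// ltW.
    suff -> : (`|x| - e) ^+ 2 / (2 * e) = (e / 2 + (2 * e)^-1 * `|x| ^+ 2) - `|x|.
      by rewrite subr_ge0.
    by field; rewrite gt_eqF.
rewrite (meanD invm_mean) ?(mean_cst invm_mean) ?(meanZ invm_mean)//; last 2 first.
- exact: bnd_cst.
- by apply: bndM => //; exact: bnd_cst.
rewrite [leRHS]splitr lerD2l (_ : e / 2 = (2 * e)^-1 * e ^+ 2); last first.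
  by field; rewrite gt_eqF.
by rewrite ler_wpM2l// invr_ge0 mulr_ge0// ltW.
Qed.

Lemma cexp_cauchy_seq (X : eqType) (H : X -> {fset J} -> R) (s : seq X) e :
  (forall x, bnd (H x)) -> 0 < e -> exists S0, forall S1 S,
  (S0 `<=` S1)%fset -> (S1 `<=` S)%fset ->
  \sum_(x <- s) invm (fun A => `|cexp S (H x) A - cexp S1 (H x) A|) <= e.
Proof.
move=> bH; elim: s e => [|x s ih] e e0.
  by exists fset0 => S1 S _ _; rewrite big_nil ltW.
have e20 : 0 < e / 2 by rewrite divr_gt0.
have [Sa ha] := ih _ e20; have [Sb hb] := cexp_cauchy (bH x) e20.
exists (Sa `|` Sb)%fset => S1 S; rewrite fsubUset => /andP[Sa1 Sb1] S1S.
by rewrite big_cons [e]splitr lerD//; [exact: hb|exact: ha].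
Qed.

(** * Convolution along the group law *)

Implicit Types F G : {fset J} -> {fset J} -> R.

(** The average of [F A B] over pairs whose sum agrees with [C] on [S]: [A] is arbitrary and [B]
    runs over the cylinder of [symd A C]. *)
Definition conv S F C :=
  invm (fun A => cexp S (F A) (symd A C)).

Definition limconv F C := ulim (fun S => conv S F C).

Section Convolution.
Variables (F : {fset J} -> {fset J} -> R) (M : R).
Hypothesis FM : forall A B, `|F A B| <= M.

Let bF A : bnd (F A). Proof. by exists M. Qed.

Lemma bnd_cexp_row S C : bnd (fun A => cexp S (F A) (symd A C)).
Proof. by exists M => A; exact: cexp_norm. Qed.

Lemma conv_norm S C : `|conv S F C| <= M.
Proof. by apply: (mean_norm_cst invm_mean) => A; exact: cexp_norm. Qed.

Lemma depends_on_conv S : depends_on S (conv S F).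
Proof.
move=> C D CD; congr invm; apply/funext => A; apply: depends_on_cexp => j jS.
by rewrite !in_symd CD.
Qed.

Lemma limconv_norm C : `|limconv F C| <= M.
Proof. by apply: (mean_norm_cst ulim_mean) => S; exact: conv_norm. Qed.

(** Once [S] contains [S0], every pair that carries weight in [conv S F C] has a sum agreeing with
    [C] on [S0]. *)
Lemma limconv_near (c e : R) C S0 : 0 <= e ->
  (forall A B, {in S0, forall j, (j \in symd A B) = (j \in C)} -> `|F A B - c| <= e) ->
  `|limconv F C - c| <= e.
Proof.
move=> e0 h; apply: (@ulim_near _ _ S0) => //.
  by exists M => S; exact: conv_norm.
move=> S /fsubsetP S0S; apply: (mean_sub_cst invm_mean); first exact: bnd_cexp_row.
move=> A; apply: cexp_near => // B BAC; apply: h => j /S0S jS.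
by rewrite in_symd BAC// in_symd addKb.
Qed.

(** Total boundedness of the rows of [F] yields one [S0] for all rows, and translation invariance
    makes it serve all [C]. *)
Lemma limconv_approx e :
  (forall e, 0 < e -> exists (X : eqType) (H : X -> {fset J} -> R) (s : seq X),
     (forall x, bnd (H x)) /\
     forall A, exists2 x, x \in s & forall B, `|F A B - H x B| <= e) ->
  0 < e -> exists S0, forall C, `|limconv F C - conv S0 F C| <= e.
Proof.
move=> tb e0; have e30 : 0 < e / 3 by rewrite divr_gt0.
have [X [H [s [bH sH]]]] := tb _ e30.
have [S0 hS0] := cexp_cauchy_seq s bH e30.
exists S0 => C; apply: (@ulim_near _ _ S0); [|exact: ltW|].
  by exists M => S; exact: conv_norm.
move=> S S0S; have b1 := bnd_cexp_row S C; have b2 := bnd_cexp_row S0 C.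
rewrite /conv -(meanB invm_mean)//.
pose G A := \sum_(x <- s) `|cexp S (H x) A - cexp S0 (H x) A|.
have bG : bnd G.
  by apply: bnd_sum => x _; apply: bnd_norm; apply: bndB; exact: bnd_cexp.
have bGC : bnd (fun A => G (symd A C)) by exact: (bnd_comp (fun A => symd A C)).
(* Two thirds of [e] pay for replacing the row [F A] by some [H x] at both levels; [G], a sum over
   the whole family, bounds the rest whichever [x] was chosen. *)
apply: (@le_trans _ _ (invm (fun A => 2 * (e / 3) + G (symd A C)))).
  apply: (mean_norm_le invm_mean) => [|A]; first by apply: bndD => //; exact: bnd_cst.
  have [x xs hx] := sH A; set B := symd A C.
  have close S1 : `|cexp S1 (F A) B - cexp S1 (H x) B| <= e / 3.
    by rewrite -cexpB//; exact: cexp_norm.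
  have : `|cexp S (H x) B - cexp S0 (H x) B| <= G B.
    by rewrite /G (big_rem x)//= lerDl sumr_ge0.
  have := close S; have := close S0; rewrite !ler_norml.
  by move=> /andP[? ?] /andP[? ?] /andP[? ?]; apply/andP; split; lra.
rewrite (meanD invm_mean)//; last exact: bnd_cst.
(* The shift invariance removes [C], which makes the bound uniform. *)
rewrite (mean_cst invm_mean) (invm_shift _ bG) (mean_sum invm_mean); last first.
  by move=> x _; apply: bnd_norm; apply: bndB; exact: bnd_cexp.
have := hS0 _ _ (fsubset_refl S0) S0S; set z := \sum_(_ <- _) _; lra.
Qed.

End Convolution.

Lemma limconv_lin a F G M N C :
  (forall A B, `|F A B| <= M) -> (forall A B, `|G A B| <= N) ->
  limconv (fun A B => a * F A B + G A B) C = a * limconv F C + limconv G C.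
Proof.
move=> FM GN; rewrite /limconv -(mean_lin ulim_mean); last 2 first.
- by exists M => S; exact: conv_norm.
- by exists N => S; exact: conv_norm.
congr ulim; apply/funext => S; rewrite /conv -(mean_lin invm_mean); last 2 first.
- exact: bnd_cexp_row FM S C.
- exact: bnd_cexp_row GN S C.
congr invm; apply/funext => A; rewrite cexp_lin//; first by exists M.
by exists N.
Qed.

End InvariantMean.

(** * The Milutin operator *)

Section Digits.
Context {R : realType}.
Implicit Types (x s : R) (v : nat -> R) (c : nat -> bool).

(** Piecewise linear ramp, 0 up to 1/3 and 1 from 2/3 on. It serves both as a probability for the
    Milutin digits and as a continuous ternary digit. *)
Definition clamp x : R := Num.max 0 (Num.min 1 (3 * x - 1)).

Lemma clamp_itv x : 0 <= clamp x <= 1.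
Proof.
by rewrite /clamp minEle maxEle; do 2 case: ifPn => /=; rewrite -?ltNge; lra.
Qed.

Lemma clamp_0 x : x <= 3^-1 -> clamp x = 0.
Proof.
by rewrite /clamp minEle maxEle; do 2 case: ifPn => /=; rewrite -?ltNge; lra.
Qed.

Lemma clamp_1 x : 2 / 3 <= x -> clamp x = 1.
Proof.
by rewrite /clamp minEle maxEle; do 2 case: ifPn => /=; rewrite -?ltNge; lra.
Qed.

Lemma clamp_continuous : continuous clamp.
Proof.
move=> x; pose g (y : R) : R^o := 3 * y - 1.
have cg : {for x, continuous g}.
  apply: cvgB; last exact: cvg_cst.
  by apply: cvgM; [exact: cvg_cst|exact: cvg_id].
have c0 : {for x, continuous (fun=> 0 : R^o)} by exact: cvg_cst.
have c1 : {for x, continuous (fun=> 1 : R^o)} by exact: cvg_cst.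
exact: continuous_max c0 (continuous_min c1 cg).
Qed.

(** Weights with sum 1. The ratio exceeds 1/2, so expansions with first digit 0 and 1 overlap on
    [[1/3, 2/3]], leaving room for a continuous random choice. *)
Definition wgt (k : nat) : R := 3^-1 * (2 / 3) ^+ k.

Definition dval v : R := limn (series (fun k => wgt k * v k)).

Section Dval.
Variable v : nat -> R.
Hypothesis v01 : forall k, 0 <= v k <= 1.

Let sv := series (fun k => wgt k * v k).

Let wgt_ge0 k : 0 <= wgt k.
Proof. by rewrite mulr_ge0// exprn_ge0. Qed.

(** The upper bound is the sum of the weights of index [n] to [n + m - 1]. *)
Let sv_incr n m : 0 <= sv (n + m)%N - sv n <= (2 / 3) ^+ n - (2 / 3) ^+ (n + m).
Proof.
elim: m => [|m]; first by rewrite addn0 !subrr lexx.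
rewrite addnS (_ : sv (n + m).+1 = sv (n + m)%N + wgt (n + m) * v (n + m)%N); last first.
  by rewrite /sv /series/= big_nat_recr.
rewrite exprS.
have := wgt_ge0 (n + m); have := v01 (n + m); rewrite /wgt.
set y := (2 / 3) ^+ (n + m) => /andP[v0 v1] y0.
have : 0 <= 3^-1 * y * v (n + m)%N <= 3^-1 * y.
  by rewrite mulr_ge0//= ler_piMr.
by move=> /andP[? ?] /andP[? ?]; apply/andP; split; lra.
Qed.

Let sv_cvg : cvgn sv.
Proof.
apply: nondecreasing_is_cvgn.
  by move=> n m /subnKC <-; have /andP[] := sv_incr n (m - n); rewrite subr_ge0.
exists 1 => _ [n _ <-]; have /andP[_] := sv_incr 0 n.
rewrite add0n expr0 [sv 0]/sv /series/= big_geq// subr0 => /le_trans; apply.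
by rewrite gerBl exprn_ge0.
Qed.

Lemma dval_approx n : `|dval v - \sum_(0 <= k < n) wgt k * v k| <= (2 / 3) ^+ n.
Proof.
have h m : (n <= m)%N -> sv n <= sv m <= sv n + (2 / 3) ^+ n.
  move=> /subnKC <-; have /andP[h1 h2] := sv_incr n (m - n).
  have : 0 <= (2 / 3) ^+ (n + (m - n)) :> R by rewrite exprn_ge0.
  by move=> ?; apply/andP; split; lra.
have lo : sv n <= dval v.
  by apply: limr_ge => //; exists n => // m /h /andP[].
have hi : dval v <= sv n + (2 / 3) ^+ n.
  by apply: limr_le => //; exists n => // m /h /andP[].
rewrite -/(sv n) ler_norml; have : 0 <= (2 / 3) ^+ n :> R by rewrite exprn_ge0.
by move=> ?; apply/andP; split; move: lo hi; rewrite /sv /series/=; lra.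
Qed.

Lemma dval_itv : 0 <= dval v <= 1.
Proof.
apply/andP; split.
  apply: limr_ge => //; apply: nearW => n.
  by have /andP[] := sv_incr 0 n; rewrite add0n [sv 0]/sv /series/= big_geq// subr0.
have := dval_approx 0; rewrite big_geq// subr0 expr0; exact: le_trans (ler_norm _).
Qed.

End Dval.

(* A random expansion s = sum_k (1/3) (2/3)^k c_k: given the first k digits, the
   remainder is (2/3)^k * st k s c, and the k-th digit is 1 with probability
   [clamp (st k s c)]. Then [sdens k] is the density of that digit with respect
   to a fair coin. *)
Fixpoint st (k : nat) s c : R :=
  if k is k'.+1 then 3 / 2 * (st k' s c - (c k')%:R / 3) else s.

Definition sdens (k : nat) s c : R :=
  2 * (if c k then clamp (st k s c) else 1 - clamp (st k s c)).

Lemma st_ext k s c d : (forall n, (n < k)%N -> c n = d n) -> st k s c = st k s d.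
Proof.
elim: k => //= k ih h; rewrite ih ?h// => n nk; apply: h; exact: ltnW.
Qed.

Lemma st_continuous k c : continuous (fun s => st k s c).
Proof.
elim: k => [|k ih] s; first exact: cvg_id.
apply: cvgM; first exact: cvg_cst.
by apply: cvgB; [exact: ih|exact: cvg_cst].
Qed.

Lemma sdens_continuous k c : continuous (fun s => sdens k s c).
Proof.
move=> s; apply: cvgM; first exact: cvg_cst.
have cs : {for s, continuous (fun s => clamp (st k s c))}.
  by apply: continuous_comp; [exact: st_continuous|exact: clamp_continuous].
by case: (c k) => //; apply: cvgB => //; exact: cvg_cst.
Qed.

Lemma sdens_itv k s c : 0 <= sdens k s c <= 2.
Proof.
rewrite /sdens; have /andP[h1 h2] := clamp_itv (st k s c).
by case: (c k); apply/andP; split; lra.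
Qed.

(** A digit 1 of nonzero density forces a remainder above 1/3, a digit 0 one below 2/3; rescaling
    then stays in [[0,1]]. *)
Lemma st_itv n s c : 0 <= s <= 1 -> (forall k, (k < n)%N -> sdens k s c != 0) ->
  0 <= st n s c <= 1.
Proof.
move=> s01; elim: n => // n ih h.
have /andP[h0 h1] : 0 <= st n s c <= 1 by apply: ih => k kn; apply: h; exact: ltnW.
have := h n (ltnSn n); rewrite /sdens /=; case: (c n) => /=.
- have [x3|x3 _] := leP (st n s c) 3^-1; first by rewrite clamp_0// mulr0 eqxx.
  by apply/andP; split; lra.
- have [x3|x3 _] := leP (2 / 3) (st n s c).
    by rewrite clamp_1// subrr mulr0 eqxx.
  by apply/andP; split; lra.
Qed.

Lemma st_digits n s c :
  s = \sum_(0 <= k < n) wgt k * (c k)%:R + (2 / 3) ^+ n * st n s c.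
Proof.
elim: n => [|n ih]; first by rewrite big_geq// add0r mul1r.
rewrite big_nat_recr//= {1}ih -addrA; congr (_ + _).
by rewrite exprSr /wgt; field.
Qed.

(** Both numbers lie within [(2 / 3) ^+ n] of the same partial sum of [n] terms. *)
Lemma sdens_near n s c : 0 <= s <= 1 -> (forall k, (k < n)%N -> sdens k s c != 0) ->
  `|s - dval (fun k => (c k)%:R)| <= 2 * (2 / 3) ^+ n.
Proof.
move=> s01 h; have /andP[x0 x1] := st_itv s01 h.
have := @dval_approx (fun k => (c k)%:R) _ n.
have {1}-> := st_digits n s c.
set y := (2 / 3) ^+ n; set z := \sum_(_ <= _ < _) _; set w := dval _ => hw.
have y0 : 0 <= y by rewrite exprn_ge0.
have : `|w - z| <= y by apply: hw => k; case: (c k); rewrite /= ?lexx ler01.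
have : 0 <= y * st n s c <= y by rewrite mulr_ge0//= ler_piMr.
rewrite !ler_norml => /andP[? ?] /andP[? ?]; apply/andP; split; lra.
Qed.

End Digits.

Section MilutinOperator.
Context {R : realType} {I : choiceType}.
Local Notation J := (I * nat)%type.
Implicit Types (t : I -> R) (A C D S : {fset J}) (j : J) (f : {fset J} -> R).

Definition digits C (i : I) : nat -> bool := fun k => (i, k) \in C.

Definition mdens t j C : R := sdens j.2 (t j.1) (digits C j.1).

(** Density of independent random expansions of the [t i], keeping only the factors with index in
    [S]. *)
Definition mkern t S C : R := \prod_(j <- S) mdens t j C.

Lemma mdens_flip t j A : mdens t j A + mdens t j (symd A [fset j]%fset) = 2.
Proof.
rewrite /mdens /sdens (@st_ext _ _ _ (digits (symd A [fset j]%fset) j.1) (digits A j.1)).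
  rewrite /digits -!surjective_pairing in_symd inE eqxx addbT.
  by case: (j \in A) => /=; ring.
move=> n nj; rewrite /digits in_symd inE; case: eqP => [e|]; rewrite ?addbF//.
by move: nj; rewrite -e ltnn.
Qed.

Lemma mdens_ext t i j A : (j.1 != i.1) || (i.2 < j.2)%N ->
  mdens t i (symd A [fset j]%fset) = mdens t i A.
Proof.
move=> ij.
have dE n : (n <= i.2)%N -> digits (symd A [fset j]%fset) i.1 n = digits A i.1 n.
  move=> ni; rewrite /digits in_symd inE; case: eqP => [e|]; rewrite ?addbF//.
  by move: ij ni; rewrite -e/= eqxx/= => /[swap] /leq_ltn_trans /[apply]; rewrite ltnn.
rewrite /mdens /sdens dE// (@st_ext _ _ _ (digits (symd A [fset j]%fset) i.1) (digits A i.1))//.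
by move=> n /ltnW; exact: dE.
Qed.

Lemma mdens_bnd t j : bnd (mdens t j).
Proof.
exists 2 => C; have /andP[h1 h2] := sdens_itv j.2 (t j.1) (digits C j.1).
by rewrite ger0_norm.
Qed.

Lemma mkern_ge0 t S C : 0 <= mkern t S C.
Proof. by apply: prodr_ge0 => j _; have /andP[] := sdens_itv j.2 (t j.1) (digits C j.1). Qed.

Lemma bnd_mkern t S : bnd (mkern t S).
Proof. by apply: bnd_prod => j; exact: mdens_bnd. Qed.

Lemma invm_mdens t f (s : seq J) : bnd f -> uniq s ->
  {in s, forall j A, f (symd A [fset j]%fset) = f A} ->
  invm (fun A => f A * \prod_(j <- s) mdens t j A) = invm f.
Proof.
(* Indices are ranked by position: the density of a digit depends only on it and on earlier digits
   of the same coordinate. *)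
move=> bf us fs; apply: (@invm_prod _ _ (mdens t) snd) => //.
- by move=> j; exact: mdens_bnd.
- by move=> j A; exact: mdens_flip.
- move=> i j A ij rij; apply: mdens_ext; rewrite ltn_neqAle rij andbT -negb_and.
  by apply: contra ij; case: i j {rij} => [i n] [j m] /= /andP[/eqP -> /eqP ->].
Qed.

Lemma mkern_mean t S : is_mean (fun f => invm (fun C => f C * mkern t S C)).
Proof.
have bk := bnd_mkern t S.
split=> [a f g bf bg|f g bf bg fg|c].
- have b1 := bndM bf bk; have b2 := bndM bg bk.
  rewrite -(mean_lin invm_mean)//; congr invm; apply/funext => C.
  by rewrite mulrDl mulrA.
- apply: (mean_le invm_mean) => [||C]; [exact: bndM..|].
  by rewrite ler_wpM2r// mkern_ge0.
- rewrite (@invm_mdens t (fun=> c) S) ?fset_uniq//; last exact: bnd_cst.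
  exact: (mean_cst invm_mean).
Qed.

Definition mil t f := ulim (fun S => invm (fun C => f C * mkern t S C)).

Lemma mil_mean t : is_mean (mil t).
Proof. exact: ulim_of_means (mkern_mean t). Qed.

(** Digit densities look at the earlier digits of their coordinate; for such [S] the kernel depends
    on digits in [S] alone. *)
Definition down_closed S :=
  forall i n m, (m <= n)%N -> (i, n) \in S -> (i, m) \in S.

Lemma exists_down_closed S : exists2 S1, (S `<=` S1)%fset & down_closed S1.
Proof.
exists [fset x in [seq (x.1, k) | x <- S, k <- iota 0 x.2.+1]]%fset.
  apply/fsubsetP => x xS; rewrite inE; apply/allpairsPdep.
  by exists x, x.2; split => //; [rewrite mem_iota/=|exact: surjective_pairing].
move=> i n m mn; rewrite !inE => /allpairsPdep[x [k [xS kx [-> nk]]]].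
apply/allpairsPdep; exists x, m; split => //.
by move: kx; rewrite !mem_iota/= -nk !add0n !ltnS; exact: leq_trans.
Qed.

Lemma depends_on_mkern t S : down_closed S -> depends_on S (mkern t S).
Proof.
move=> dS A B AB; rewrite /mkern big_seq [RHS]big_seq; apply: eq_bigr => -[i n] iS.
have dAB m : (m <= n)%N -> digits A i m = digits B i m.
  by move=> mn; apply: AB; exact: dS iS.
rewrite /mdens /sdens/= dAB// (@st_ext _ _ _ (digits A i) (digits B i))//.
by move=> m /ltnW; exact: dAB.
Qed.

(** The factors outside [S] integrate to 1, so the net is eventually constant; its value is a finite
    sum, from which continuity in [t] is read off. *)
Lemma mil_depends_on S t f : bnd f -> down_closed S -> depends_on S f ->
  mil t f = avg S (fun D => f D * mkern t S D).
Proof.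
move=> bf dS df; have dk := depends_on_mkern t dS.
have bk := bnd_mkern t S.
transitivity (invm (fun A => f A * mkern t S A)).
  rewrite -[RHS](mean_cst (@ulim_mean R J)); apply: (@ulim_eq _ _ S).
  - have [M hM] := bf; exists M => S'.
    exact: (mean_norm_cst (mkern_mean t S')).
  - exact: bnd_cst.
  - move=> S' SS'; rewrite -[RHS](@invm_mdens t _ (S' `\` S)%fset) ?fset_uniq//.
    + congr invm; apply/funext => A; rewrite -mulrA; congr (_ * _).
      rewrite /mkern -big_cat/=; apply: perm_big; apply: uniq_perm.
      * exact: fset_uniq.
      * rewrite cat_uniq !fset_uniq andbT/=; apply/hasPn => x.
        by rewrite inE => /andP[].
      * move=> x; rewrite mem_cat inE; have [xS|//] := boolP (x \in S).
        by rewrite (fsubsetP SS').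
    + exact: bndM.
    + move=> j; rewrite inE => /andP[jS _] A.
      exact: (depends_on_flip (depends_onM df dk)).
transitivity (invm (fun A => 1 * (f A * mkern t S A))).
  by congr invm; apply/funext => A; rewrite mul1r.
rewrite (invm_cylE (bnd_cst 1) (depends_onM df dk)); congr avg; apply/funext => D.
by rewrite cexp_id ?mulr1//; exact: bnd_cst.
Qed.

Definition rho C (i : I) : R := dval (fun k => (digits C i k)%:R).

Lemma rho_agree C D i n e : (forall k, (k < n)%N -> digits C i k = digits D i k) ->
  2 * (2 / 3) ^+ n <= e -> `|rho C i - rho D i| <= e.
Proof.
move=> CD; apply: le_trans.
have h E k : 0 <= ((digits E i k)%:R : R) <= 1 by case: (digits E i k); rewrite /= ?lexx ler01.
have := dval_approx (h C) n; have := dval_approx (h D) n.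
rewrite [in X in _ -> X -> _](@eq_big_nat _ _ _ _ _ _ (fun k => wgt k * (digits D i k)%:R)).
  rewrite -!/(rho _ _); set z := \sum_(_ <= _ < _) _; rewrite !ler_norml.
  by move=> /andP[? ?] /andP[? ?]; apply/andP; split; lra.
by move=> k /andP[_ kn]; rewrite CD.
Qed.

(** Where the kernel is nonzero, so are its digit densities, and [sdens_near] places [rho C] near
    [t] on [F]; other [C] contribute nothing. *)
Lemma mil_near t f (c e : R) (F : seq I) n : bnd f -> 0 <= e ->
  (forall i, 0 <= t i <= 1) ->
  (forall C, {in F, forall i, `|t i - rho C i| <= 2 * (2 / 3) ^+ n} -> `|f C - c| <= e) ->
  `|mil t f - c| <= e.
Proof.
move=> bf e0 t01 h.
pose S0 := [fset x in [seq (i, k) | i <- F, k <- iota 0 n]]%fset.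
apply: (@ulim_near _ _ S0) => //.
  by have [M hM] := bf; exists M => S'; exact: (mean_norm_cst (mkern_mean t S')).
move=> S S0S; rewrite -{1}(mean_cst (mkern_mean t S) c) -(meanB (mkern_mean t S))//; last first.
  exact: bnd_cst.
have bk := bnd_mkern t S.
rewrite -(mean_cst (mkern_mean t S) e).
apply: (mean_norm_le invm_mean) => [|C]; first by apply: bndM => //; exact: bnd_cst.
rewrite normrM (ger0_norm (mkern_ge0 _ _ _)).
have [->|k0] := eqVneq (mkern t S C) 0; first by rewrite !mulr0.
rewrite ler_wpM2r ?mkern_ge0//; apply: h => i iF; apply: sdens_near => // k kn.
have iS : (i, k) \in S.
  apply: (fsubsetP S0S); rewrite inE; apply/allpairsP; exists (i, k).
  by rewrite mem_iota.
by move: k0; rewrite /mkern (big_rem _ iS)/= mulf_eq0 negb_or => /andP[].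
Qed.

End MilutinOperator.

(** * Continuous functions and the cube *)

Section ContinuousFunctions.
Context {R : realType}.

Lemma near_norm_le (T : Type) (F : set_system T) (FF : Filter F) (f : T -> R) (l e : R) :
  f @ F --> l -> 0 < e -> \forall x \near F, `|f x - l| <= e.
Proof.
move=> fl e0; have /cvgrPdist_le/(_ e e0) := fl.
by apply: (@filterS _ F) => x; rewrite distrC.
Qed.

Lemma continuous_approx (T : topologicalType) (q : T -> R) :
  (forall e, 0 < e -> exists2 g : T -> R, continuous g & forall x, `|q x - g x| <= e) ->
  continuous q.
Proof.
move=> h x; apply/cvgrPdist_le => e e0; have e3 : 0 < e / 3 by rewrite divr_gt0.
have [g cg qg] := h _ e3.
have := near_norm_le (nbhs_filter x) (cg x) e3; apply: filterS => y.
have := qg x; have := qg y; rewrite !ler_norml.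
by move=> /andP[? ?] /andP[? ?] /andP[? ?]; apply/andP; split; lra.
Qed.

Lemma continuous_sum (T : topologicalType) (X : Type) (s : seq X) (F : X -> T -> R) :
  (forall k, continuous (F k)) -> continuous (fun x => \sum_(k <- s) F k x).
Proof.
move=> cF; elim: s => [|k s ih] x.
  by under eq_fun do rewrite big_nil; exact: cvg_cst.
by under eq_fun do rewrite big_cons; apply: cvgD; [exact: cF|exact: ih].
Qed.

Lemma continuous_prod (T : topologicalType) (X : Type) (s : seq X) (F : X -> T -> R) :
  (forall k, continuous (F k)) -> continuous (fun x => \prod_(k <- s) F k x).
Proof.
move=> cF; elim: s => [|k s ih] x.
  by under eq_fun do rewrite big_nil; exact: cvg_cst.
by under eq_fun do rewrite big_cons; apply: cvgM; [exact: cF|exact: ih].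
Qed.

Lemma compact_bnd (T : topologicalType) (f : T -> R) :
  compact [set: T] -> continuous f -> bnd f.
Proof.
move=> cT cf.
have : compact (f @` [set: T]).
  by apply: continuous_compact => //; exact: continuous_subspaceT.
move/compact_bounded => [M [_ hM]]; exists (M + 1) => x.
by apply: hM; [rewrite ltrDl|exists x].
Qed.

Lemma supnorm_ge (T : topologicalType) (f : T -> R) x : bnd f -> `|f x| <= supnorm f.
Proof.
move=> [M hM]; apply: ub_le_sup; last by exists x.
by exists M => _ [y _ <-].
Qed.

Lemma supnorm_le (T : topologicalType) (f : T -> R) (x0 : T) M :
  (forall x, `|f x| <= M) -> supnorm f <= M.
Proof.
by move=> hM; apply: ge_sup => [|_ [x _ <-]//]; exists `|f x0|, x0.
Qed.

(* Compactness of [L] turns [x |-> f (x, _)] into a norm-continuous map, whose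
   image is totally bounded because [K] is compact. *)
Lemma compact_rows (K L : topologicalType) (f : K * L -> R) e :
  compact [set: K] -> compact [set: L] -> continuous f -> 0 < e ->
  exists s : seq K, forall x, exists2 x', x' \in s & forall y, `|f (x, y) - f (x', y)| <= e.
Proof.
move=> /compact_near_coveringP cK /compact_near_coveringP cL cf e0.
have e2 : 0 < e / 2 by rewrite divr_gt0.
have tube x : \forall x' \near x, forall y, `|f (x', y) - f (x, y)| <= e.
  have : \forall x' \near x, [set: L] `<=` (fun y => `|f (x', y) - f (x, y)| <= e).
    apply: (cL K (nbhs x) (fun x' y => `|f (x', y) - f (x, y)| <= e)) => y _.
    have [[/= U V] [Ux Vy] UV] := near_norm_le (nbhs_filter (x, y)) (cf (x, y)) e2.
    exists (V, U) => //= -[y' x'] [/= Vy' Ux'].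
    have /= h1 := UV (x', y') (conj Ux' Vy').
    have /= h2 := UV (x, y') (conj (nbhs_singleton Ux) Vy').
    by move: h1 h2; rewrite !ler_norml => /andP[? ?] /andP[? ?]; apply/andP; split; lra.
  by apply: filterS => x' h y; apply: h.
(* Applied with the filter of finite sets ordered by inclusion, the covering form of compactness
   gives one finite set that serves every [x]. *)
pose F := filter_from [set: {fset K}] (fun S0 => [set S | (S0 `<=` S)%fset]).
have FF : Filter F.
  apply: filter_from_filter; first by exists fset0.
  move=> A B _ _; exists (A `|` B)%fset => // S /=.
  by rewrite fsubUset => /andP[].
pose P (S : {fset K}) x := exists2 x', x' \in S & forall y, `|f (x, y) - f (x', y)| <= e.
have : \forall S \near F, [set: K] `<=` P S.
  apply: (cK {fset K} F P) => x _; exists ([set x' | forall y, `|f (x', y) - f (x, y)| <= e],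
                      [set S | ([fset x] `<=` S)%fset]) => /=.
    by split; [exact: tube|exists [fset x]%fset].
  move=> [x' S] [/= hx' xS]; exists x => //.
  by move: xS; rewrite fsub1set.
case=> S0 _ hS0; exists S0 => x; apply: (hS0 S0) => //=; exact: fsubset_refl.
Qed.

(** Enlarging [S] to a down-closed set turns the operator into a finite sum of products of
    continuous digit densities. *)
Lemma mil_continuous (T : topologicalType) (I : choiceType) (v : T -> I -> R)
    (S : {fset I * nat}) (f : {fset I * nat} -> R) :
  (forall i, continuous (v ^~ i)) -> bnd f -> depends_on S f ->
  continuous (fun x => mil (v x) f).
Proof.
move=> cv bf df; have [S1 SS1 dS1] := exists_down_closed S.
rewrite (_ : (fun x => _) = fun x => avg S1 (fun D => f D * mkern (v x) S1 D)); last first.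
  by apply/funext => x; apply: mil_depends_on => //; exact: depends_on_sub df.
move=> x; apply: cvgM; last exact: cvg_cst.
apply: continuous_sum => D y; apply: cvgM; first exact: cvg_cst.
apply: continuous_prod => j z.
apply: (@continuous_comp _ _ _ (v ^~ j.1) (fun s => sdens j.2 s (digits D j.1))).
  exact: cv.
exact: sdens_continuous.
Qed.

End ContinuousFunctions.

(** * The topology of the cube *)

Section Cube.
Context {R : realType} {I : Type}.

(** [{classic I}] gives an arbitrary index type the choice structure that finite sets require. *)
Definition coord (u : cube R I) (i : {classic I}) : R := (set_val u) i.

Lemma coord_itv u i : 0 <= coord u i <= 1.
Proof. by have := set_valP u; exact. Qed.

Definition mkcube (v : {classic I} -> R) (h : forall i, 0 <= v i <= 1) : cube R I :=
  exist (fun g => g \in @cube_set R I) v (mem_set h).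

Lemma coord_mkcube v h i : coord (@mkcube v h) i = v i.
Proof. by []. Qed.

Lemma cvg_initial (S : choiceType) (T : topologicalType) (f : S -> T)
    (F : set_system S) {FF : Filter F} (s : S) :
  f @ F --> f s -> F --> (s : initial_topology f).
Proof.
move=> h A /= [_ [[B Bop <-] Bfs sBfA]].
have : F (f @^-1` B) by apply: h; exact: open_nbhs_nbhs.
by apply: filterS.
Qed.

Lemma cube_cvgP (F : set_system (cube R I)) {FF : Filter F} (u : cube R I) :
  (forall i, coord ^~ i @ F --> coord u i) -> F --> u.
Proof.
move=> h; apply: cvg_initial; apply/cvg_sup => i; apply: cvg_initial; exact: h.
Qed.

Lemma coord_continuous i : continuous (coord ^~ i).
Proof.
move=> u; have uu : set_val @ u --> (set_val u : {ptws I -> R}) by exact: initial_continuous.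
have /cvg_sup/(_ i) ui := uu.
move=> A uA; apply: (ui _ ((fun f : I -> R => f i) @^-1` A)).
  by apply: fmap_filter; exact: nbhs_filter.
exact: (@initial_continuous {ptws I -> R} R (fun f => f i) (set_val u) A uA).
Qed.

Lemma cube_continuous (X : topologicalType) (g : X -> cube R I) :
  (forall i, continuous (fun x => coord (g x) i)) -> continuous g.
Proof. by move=> cg x; apply: cube_cvgP => i; exact: cg. Qed.

(** Boxes around [u] in finitely many coordinates generate a filter that converges to [u]
    coordinatewise, hence in the cube; [h] converges along it. *)
Lemma cube_nbhs (h : cube R I -> R) (u : cube R I) (e : R) :
  {for u, continuous h} -> 0 < e -> exists (F : seq {classic I}) (d : R), 0 < d /\
  forall v, {in F, forall i, `|coord v i - coord u i| <= d} -> `|h v - h u| <= e.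
Proof.
move=> ch e0.
pose B (p : {fset {classic I}} * R) :=
  [set v | {in p.1, forall i, `|coord v i - coord u i| <= p.2}].
pose G := filter_from [set p : {fset {classic I}} * R | 0 < p.2] B.
have FG : Filter G.
  apply: filter_from_filter; first by exists (fset0, 1) => /=.
  move=> [F1 d1] [F2 d2] /= d10 d20; exists ((F1 `|` F2)%fset, Num.min d1 d2) => /=.
    by rewrite lt_min d10.
  move=> v hv; split=> i /= iF; have := hv i; rewrite /= inE iF ?orbT le_min => /(_ isT) /andP[]//.
have Gu : G --> u.
  apply: cube_cvgP => i; apply/cvgrPdist_le => d d0.
  exists ([fset i]%fset, d) => // v /= /(_ i); rewrite inE eqxx distrC; exact.
have hG : h @ G --> h u by apply: cvg_trans ch; exact: cvg_app.
have [[F d] /= d0 hF] := near_norm_le FG hG e0.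
by exists F, d; split => // v hv; exact: (hF v).
Qed.

End Cube.

(** * Continuous ternary digits and points with prescribed digits *)

Section Bits.
Context {R : realType}.

(* On the Cantor ternary set, [clamp] is the first digit (0 or 2, halved) and
   [tshift] the shift. *)
Definition tshift (s : R) : R := 3 * s - 2 * clamp s.

Definition bit (k : nat) (s : R) : R := clamp (iter k tshift s).

Lemma bit_continuous k : continuous (bit k).
Proof.
have ct : continuous tshift.
  move=> s; apply: cvgB; apply: cvgM; try exact: cvg_cst; first exact: cvg_id.
  exact: clamp_continuous.
move=> s; apply: (@continuous_comp _ _ _ (iter k tshift) clamp); last exact: clamp_continuous.
elim: k s => [|k ih] s; first exact: cvg_id.
by apply: (@continuous_comp _ _ _ (iter k tshift) tshift); [exact: ih|exact: ct].
Qed.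

(** Digits are prepended one at a time, starting from the point 0; finite supports suffice, as the
    prescribed digits come from finite sets. *)
Lemma bit_surj (c : nat -> bool) n : (forall k, (n <= k)%N -> c k = false) ->
  exists2 s, 0 <= s <= 1 & forall k, bit k s = (c k)%:R.
Proof.
elim: n c => [|n ih] c cn.
  exists 0; first by rewrite lexx ler01.
  have t0 : tshift 0 = 0 by rewrite /tshift clamp_0 ?invr_ge0// !mulr0 subrr.
  move=> k; rewrite cn// /bit (_ : iter k tshift 0 = 0) ?clamp_0 ?invr_ge0//.
  by elim: k => //= k ->.
have [s' /andP[s0 s1] hs'] : exists2 s, 0 <= s <= 1 & forall k, bit k s = (c k.+1)%:R.
  by apply: ih => k nk; exact: cn.
(* The Cantor point with first ternary digit [2 * c 0], followed by the digits of [s']. *)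
pose s := (s' + 2 * (c 0)%:R) / 3.
have cs : clamp s = (c 0)%:R.
  rewrite /s; case: (c 0) => /=.
    by rewrite clamp_1//; lra.
  by rewrite clamp_0//; lra.
exists s; first by rewrite /s; case: (c 0) => /=; apply/andP; split; lra.
case=> [|k]; first by rewrite /bit.
by rewrite -hs' /bit iterSr; congr (clamp (iter _ _ _)); rewrite /tshift cs /s; field.
Qed.

(** Polynomial extension of addition modulo 2, since [bit] also takes values strictly between 0 and
    1. *)
Definition xorr (a b : R) := a + b - 2 * a * b.

Lemma xorr_itv a b : 0 <= a <= 1 -> 0 <= b <= 1 -> 0 <= xorr a b <= 1.
Proof. by rewrite /xorr => /andP[? ?] /andP[? ?]; apply/andP; split; nra. Qed.

Lemma xorr_bool (a b : bool) : xorr a%:R b%:R = (a (+) b)%:R.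
Proof. by rewrite /xorr; case: a; case: b => /=; ring. Qed.

End Bits.

Section Points.
Context {R : realType} {I : Type} {K : topologicalType} (f : K -> cube R I).
Hypothesis sf : range f = [set: cube R I].

Lemma exists_point (A : {fset {classic I} * nat}) :
  exists x, forall i k, bit k (coord (f x) i) = (digits A i k)%:R.
Proof.
have h i : exists s : R, 0 <= s <= 1 /\ forall k, bit k s = (digits A i k)%:R.
  have Ai k : (\max_(x <- A) x.2.+1 <= k)%N -> digits A i k = false.
    move=> hk; apply/negbTE/negP => ikA; move: hk.
    rewrite leqNgt => /negP; apply.
    have := @leq_bigmax_seq _ (enum_fset A) xpredT (fun x => x.2.+1) (i, k) ikA isT.
    exact.
  have [s s01 hs] := @bit_surj R _ _ Ai.
  by exists s.
have [v hv] := choice h.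
have [x _ fx] : range f (@mkcube R I v (fun i => (hv i).1)) by rewrite sf.
by exists x => i k; rewrite fx coord_mkcube (hv i).2.
Qed.

(** Chosen with no continuity in [A], which is why the means act on arbitrary bounded functions. *)
Definition point A := sval (cid (exists_point A)).

Lemma pointP A i k : bit k (coord (f (point A)) i) = (digits A i k)%:R.
Proof. exact: (svalP (cid (exists_point A))). Qed.

End Points.

(** * The complemented copy *)

Lemma exists_pow_le (R : realType) (e : R) : 0 < e -> exists n, 2 * (2 / 3) ^+ n <= e.
Proof.
move=> e0; have : geometric (2 : R) (2 / 3) @ \oo --> 0.
  by apply: cvg_geometric; rewrite ger0_norm; lra.
move=> /cvgrPdist_le/(_ e e0) [n _ /(_ n (leqnn n))] /=.
by rewrite sub0r normrN; exists n; apply: le_trans (ler_norm _) _.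
Qed.

Section ComplementedCopy.
Context {R : realType} {I : Type} {K1 K2 : topologicalType}.
Variables (f1 : K1 -> cube R I) (f2 : K2 -> cube R I).
Hypotheses (cK1 : compact [set: K1]) (cK2 : compact [set: K2]).
Hypotheses (cf1 : continuous f1) (cf2 : continuous f2).
Hypotheses (sf1 : range f1 = [set: cube R I]) (sf2 : range f2 = [set: cube R I]).

Let cK : compact [set: K1 * K2].
Proof. by rewrite -setXTT; exact: compact_setX. Qed.

Let cC : compact [set: cube R I].
Proof. by rewrite -sf1; apply: continuous_compact => //; exact: continuous_subspaceT. Qed.

Definition xor_bits (z : K1 * K2) (i : {classic I}) k : R :=
  xorr (bit k (coord (f1 z.1) i)) (bit k (coord (f2 z.2) i)).

Lemma xor_bits_itv z i k : 0 <= xor_bits z i k <= 1.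
Proof. by apply: xorr_itv; exact: clamp_itv. Qed.

Lemma xor_bits_continuous i k : continuous (fun z => xor_bits z i k).
Proof.
have h (X : topologicalType) (f : X -> cube R I) : continuous f ->
    continuous (fun x => bit k (coord (f x) i)).
  move=> cf x; apply: (@continuous_comp _ _ _ (fun x => coord (f x) i)).
    by apply: (@continuous_comp _ _ _ f (coord ^~ i)); [exact: cf|exact: coord_continuous].
  exact: bit_continuous.
have h1 : continuous (fun z : K1 * K2 => bit k (coord (f1 z.1) i)).
  by apply: (h _ (fun z => f1 z.1)) => z; apply: continuous_comp; [exact: cvg_fst|exact: cf1].
have h2 : continuous (fun z : K1 * K2 => bit k (coord (f2 z.2) i)).
  by apply: (h _ (fun z => f2 z.2)) => z; apply: continuous_comp; [exact: cvg_snd|exact: cf2].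
move=> z; apply: cvgB; first by apply: cvgD; [exact: h1|exact: h2].
by apply: cvgM; [apply: cvgM; [exact: cvg_cst|exact: h1]|exact: h2].
Qed.

Definition glue (z : K1 * K2) : cube R I :=
  mkcube (fun i => dval_itv (xor_bits_itv z i)).

Lemma glue_continuous : continuous glue.
Proof.
apply: cube_continuous => i; apply: continuous_approx => e e0.
have [n hn] := exists_pow_le e0.
exists (fun z => \sum_(0 <= k < n) wgt k * xor_bits z i k).
  apply: continuous_sum => k z.
  by apply: cvgM; [exact: cvg_cst|exact: xor_bits_continuous].
move=> z; have := dval_approx (xor_bits_itv z i) n.
rewrite coord_mkcube => /le_trans; apply; apply: le_trans hn.
by rewrite ler_peMl ?exprn_ge0// ler1n.
Qed.

Implicit Types (g h : K1 * K2 -> R) (u : cube R I -> R).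

Definition sample (g : K1 * K2 -> R) (A B : {fset {classic I} * nat}) : R :=
  g (point sf1 A, point sf2 B).

(** At the chosen points every digit is 0 or 1, so [xorr] is exact addition modulo 2. *)
Lemma coord_glue A B i : coord (glue (point sf1 A, point sf2 B)) i = rho (symd A B) i.
Proof.
rewrite coord_mkcube /rho; congr dval; apply/funext => k.
by rewrite /xor_bits !pointP xorr_bool /digits in_symd.
Qed.

Definition retract (g : K1 * K2 -> R) (t : cube R I) : R :=
  mil (coord t) (limconv (sample g)).

Let bndK (g : K1 * K2 -> R) : continuous g -> bnd g.
Proof. exact: compact_bnd. Qed.

Lemma sample_norm g A B : continuous g -> `|sample g A B| <= supnorm g.
Proof. by move=> cg; apply: supnorm_ge; exact: bndK. Qed.

Lemma bnd_limconv g : continuous g -> bnd (limconv (sample g)).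
Proof.
move=> cg; exists (supnorm g) => C; apply: limconv_norm => A B; exact: sample_norm.
Qed.

Lemma retract_norm g t : continuous g -> `|retract g t| <= supnorm g.
Proof.
move=> cg; apply: (mean_norm_cst (mil_mean (coord t))) => C.
by apply: limconv_norm => A B; exact: sample_norm.
Qed.

Lemma retract_lin (a : R) g h t : continuous g -> continuous h ->
  retract (fun z => a * g z + h z) t = a * retract g t + retract h t.
Proof.
move=> cg ch; rewrite /retract -(mean_lin (mil_mean _)); [|exact: bnd_limconv..].
congr mil; apply/funext => C.
by apply: limconv_lin => A B; exact: sample_norm.
Qed.

(** The convolution is uniformly close to functions of finitely many digits, whose Milutin images
    are continuous. *)
Lemma retract_continuous g : continuous g -> continuous (retract g).
Proof.
move=> cg; apply: continuous_approx => e e0.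
have gM A B := sample_norm A B cg.
have [d d0|S0 hS0] := limconv_approx gM _ e0.
  have [s hs] := compact_rows cK1 cK2 cg d0.
  exists K1, (fun x B => g (x, point sf2 B)), s; split.
    by move=> x; exists (supnorm g) => B; apply: supnorm_ge; exact: bndK.
  by move=> A; have [x xs hx] := hs (point sf1 A); exists x => // B; exact: hx.
have bh : bnd (conv S0 (sample g)) by exists (supnorm g) => C; exact: conv_norm.
exists (fun t => mil (coord t) (conv S0 (sample g))).
  apply: (@mil_continuous _ _ _ coord S0) => //; last exact: depends_on_conv.
  exact: coord_continuous.
move=> t; rewrite /retract -(meanB (mil_mean _))//; last exact: bnd_limconv.
exact: (mean_norm_cst (mil_mean _)).
Qed.

(** Up to any given error, both averages at [t] run over pairs whose glued image is close to [t],
    where [u] is nearly [u t]. *)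
Lemma retract_glue u : continuous u -> retract (u \o glue) = u.
Proof.
move=> cu; apply/funext => t.
have cug : continuous (u \o glue).
  by move=> z; apply: continuous_comp; [exact: glue_continuous|exact: cu].
apply/eqP; rewrite -subr_eq0 -normr_le0; apply/ler_addgt0Pr => e e0; rewrite add0r.
have [F [d [d0 hF]]] := cube_nbhs (cu t) e0.
(* Half of [d] is for the distance from [t] to [rho C], half for that from [rho C] to
   [rho (symd A B)]. *)
have d20 : 0 < d / 2 by rewrite divr_gt0.
have [n hn] := exists_pow_le d20.
apply: (@mil_near _ _ _ _ _ e F n); [exact: bnd_limconv|exact: ltW|exact: coord_itv|].
move=> C hC; pose S0 := [fset x in [seq (i, k) | i <- F, k <- iota 0 n]]%fset.
apply: (@limconv_near _ _ _ _ _ _ _ _ S0); [by move=> A B; exact: sample_norm cug|exact: ltW|].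
move=> A B hAB; apply: hF => i iF; rewrite coord_glue.
have h1 : `|rho (symd A B) i - rho C i| <= d / 2 :> R.
  apply: rho_agree hn => k kn; apply: hAB; rewrite inE; apply/allpairsP.
  by exists (i, k); rewrite mem_iota.
have := le_trans (hC i iF) hn; move: h1; rewrite !ler_norml.
by move=> /andP[? ?] /andP[? ?]; apply/andP; split; lra.
Qed.

Lemma complemented_copy : has_complemented_copy R (K1 * K2)%type (cube R I).
Proof.
(* A base point, so that the suprema are over nonempty sets. *)
have z0 : K1 * K2 := (point sf1 fset0, point sf2 fset0).
have bC (u : cube R I -> R) : continuous u -> bnd u by exact: compact_bnd.
have cglue (u : cube R I -> R) : continuous u -> continuous (u \o glue).
  by move=> cu z; apply: continuous_comp; [exact: glue_continuous|exact: cu].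
(* The left inverse followed by the embedding is a projection onto the copy; both maps have norm at
   most 1. *)
exists (fun g => retract g \o glue), (fun u => u \o glue); split.
- split=> [g cg|a g h cg ch|].
  + by apply: cglue; exact: retract_continuous.
  + by apply/funext => z /=; rewrite retract_lin.
  + exists 1 => g cg; rewrite mul1r; apply: (supnorm_le z0) => z.
    exact: retract_norm.
- by move=> g cg; rewrite retract_glue//; exact: retract_continuous.
- split=> [u cu|//|]; first exact: cglue.
  exists 1 => u cu; rewrite mul1r; apply: (supnorm_le z0) => z.
  exact: (supnorm_ge (glue z) (bC u cu)).
- apply/seteqP; split=> _ [g cg <-].
    by exists (g \o glue); [exact: cglue|rewrite retract_glue].
  by exists (retract g) => //; exact: retract_continuous.
- exists 1; split=> // u cu; rewrite mul1r; apply: (supnorm_le (glue z0)) => t.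
  rewrite -{1}(retract_glue cu); apply: retract_norm; exact: cglue.
Qed.

End ComplementedCopy.

Theorem theorem1p2 (R : realType) (K1 K2 : topologicalType) (I : Type)
  (hK1 : compact [set: K1]) (hH1 : hausdorff_space K1)
  (hK2 : compact [set: K2]) (hH2 : hausdorff_space K2)
  (hI : inhabited I)
  (f1 : K1 -> cube R I) (f2 : K2 -> cube R I)
  (cf1 : continuous f1) (sf1 : range f1 = [set: cube R I])
  (cf2 : continuous f2) (sf2 : range f2 = [set: cube R I]) :
  has_complemented_copy R (K1 * K2)%type (cube R I).
Proof. exact: (complemented_copy hK1 hK2 cf1 cf2 sf1 sf2). Qed.
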